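(* Let $B_0\in\mathbb{R}^{n\times n}$ and let $B_1,\dots,B_N\in\mathbb{R}^{n\times n}$ be rank-one matrices such that either $B_i=bc_i^T$ for all $i=1,\dots,N$ (with a common column vector $b\in\mathbb{R}^n$ and $c_i\in\mathbb{R}^n$), or $B_i=b_ic^T$ for all $i=1,\dots,N$ (with a common column vector $c\in\mathbb{R}^n$ and $b_i\in\mathbb{R}^n$). Let $A_i=B_0+B_i$ for $i=1,\dots,N$, assume that every $A_i$ is Schur stable, and let $\mathcal{A}=\mathrm{co}\{A_1,\dots,A_N\}$ be the convex hull. With $\cdot$ denoting the bialternate product, $d=n(n-1)/2$, and $I_d$ the $d\times d$ identity matrix, put for $1\le i<j\le N$ $$F_0^{ij}=I_d-A_j\cdot A_j,\qquad F_1^{ij}=-2(A_i\cdot A_j-A_j\cdot A_j).$$ Then every matrix in $\mathcal{A}$ is Schur stable if and only if both of the following hold: (i) $(I-A_i)(I-A_j)^{-1}$ and $(I+A_i)(I+A_j)^{-1}$ have no negative real eigenvalues for all $1\le i<j\le N$; (ii) $-(F_0^{ij})^{-1}F_1^{ij}$ has no real eigenvalue in $[1,\infty)$ for all $1\le i<j\le N$.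
   Context: A real $n\times n$ matrix is Schur stable if all its (complex) eigenvalues lie in the open unit disk. $I$ is the $n\times n$ identity matrix. Bialternate product: for $A=[a_{ij}],B=[b_{ij}]\in\mathbb{R}^{n\times n}$, $A\cdot B$ is the $d\times d$ matrix, $d=n(n-1)/2$, with rows and columns indexed (in a fixed order) by the pairs $(p,q)$ with $1\le p<q\le n$, whose entry in row $(i,j)$ and column $(k,l)$ is $$f_{ij,kl}=\frac12\left(\begin{vmatrix} a_{ik} & a_{il} \\ b_{jk} & b_{jl} \end{vmatrix}+\begin{vmatrix} b_{ik} & b_{il} \\ a_{jk} & a_{jl} \end{vmatrix}\right).$$ When $A_j$ is Schur stable, $F_0^{ij}$ is invertible, since the eigenvalues of $A_j\cdot A_j$ are the products of pairs (with distinct indices) of eigenvalues of $A_j$. *)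

(* Defs.v *)
From mathcomp Require Import all_boot all_order all_algebra.
From mathcomp Require Import complex reals.

Set Implicit Arguments.
Unset Strict Implicit.
Unset Printing Implicit Defensive.

Import Order.TTheory GRing.Theory Num.Theory.
Local Open Scope ring_scope.

(* [`|z|] is the modulus, as an element of R[i] with zero imaginary part. *)
Definition schur_stable (R : realType) (n : nat) (A : 'M[R]_n) : Prop :=
  forall z : R[i], eigenvalue (map_mx (real_complex R) A) z -> `|z| < 1.

Definition in_conv_hull (R : realType) (n N : nat) (A : 'I_N -> 'M[R]_n)
    (M : 'M[R]_n) : Prop :=
  exists w : 'I_N -> R,
    [/\ forall i, 0 <= w i, \sum_(i < N) w i = 1
      & M = \sum_(i < N) w i *: A i].

Definition ltpairs (n : nat) : {set 'I_n * 'I_n} :=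
  [set p : 'I_n * 'I_n | (p.1 < p.2)%N].

Definition bialt_dim (n : nat) : nat := (n * n.-1)./2.

Lemma card_ltpairs (n : nat) : #|ltpairs n| = bialt_dim n.
Proof.
rewrite /bialt_dim -bin2 -bin2_sum big_mkord -sum1_card.
rewrite (eq_bigl (fun p : 'I_n * 'I_n => (p.1 < p.2)%N)); last first.
  by move=> p; rewrite inE.
rewrite -(pair_big_dep xpredT (fun i j : 'I_n => (i < j)%N) (fun _ _ => 1%N)) /=.
rewrite (exchange_big_dep xpredT) //=; apply: eq_bigr => j _.
by rewrite -(big_ord_widen _ (fun=> 1%N) (ltnW (ltn_ord j))) sum1_card card_ord.
Qed.

(* The fixed order on the pairs (p, q), p < q, is that of [enum (ltpairs n)]. *)
Definition bialt_pair (n : nat) (r : 'I_(bialt_dim n)) : 'I_n * 'I_n :=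
  enum_val (cast_ord (esym (card_ltpairs n)) r).

Definition bialternate (R : realType) (n : nat) (A B : 'M[R]_n) :
    'M[R]_(bialt_dim n) :=
  \matrix_(r, s)
    let: (i, j) := bialt_pair r in
    let: (k, l) := bialt_pair s in
    2^-1 * ((A i k * B j l - A i l * B j k)
            + (B i k * A j l - B i l * A j k)).

Definition bialt_F0 (R : realType) (n : nat) (Aj : 'M[R]_n) :
    'M[R]_(bialt_dim n) :=
  1%:M - bialternate Aj Aj.

Definition bialt_F1 (R : realType) (n : nat) (Ai Aj : 'M[R]_n) :
    'M[R]_(bialt_dim n) :=
  - (2 *: (bialternate Ai Aj - bialternate Aj Aj)).

(* Main.v *)
(* By the matrix determinant lemma the characteristic polynomial is affine along
   segments whose direction is of the form [u *m v], hence along every segment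
   of the hull.  The theorem thus splits into two parts.

   Segments.  Moving from the stable end [M] to [M'], stability can only be lost
   through an eigenvalue [z] of modulus 1.  The eigenvalues [z = 1] and [z = -1]
   are excluded by (i).  If [z] is not real, then [z * conj z = 1] is an
   eigenvalue of [X . X], where [X = segment M M' t]; as the second compound of
   [M' - M] vanishes, [1 - X . X] is [F0 + t F1], and (ii) excludes this.

   From segments to the hull.  The hull is exhausted by repeatedly joining a point
   to a vertex, so it suffices to show that a triangle with stable edges is
   stable.  The three characteristic polynomials take nonzero values [p(z)],
   [q(z)], [r(z)] on the unit circle, no two of them in opposite directions.  If
   [0] were in the triangle of values at [z0], then moving [z] from [z0] to [1],
   where the three values are real of the same sign, would force two of them to
   be in opposite directions at some point (a special case of the edge theorem
   of Bartlett, Hollot and Huang). *)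
Require Import Defs.
From mathcomp Require Import all_boot all_order all_algebra.
From mathcomp Require Import complex reals.
From mathcomp Require Import boolp classical_sets topology normedtype realfun.
From mathcomp Require Import ring lra.

Set Implicit Arguments.
Unset Strict Implicit.
Unset Printing Implicit Defensive.

Import Order.TTheory GRing.Theory Num.Theory.
Import numFieldNormedType.Exports.
Local Open Scope ring_scope.

(** * Stability of polynomials along a segment *)

Lemma prodr_const_seq (S : pzSemiRingType) (I : Type) (s : seq I) (x : S) :
  \prod_(i <- s) x = x ^+ size s.
Proof. by rewrite big_const_seq count_predT iter_mulr_1. Qed.

Definition poly_schur (C : numClosedFieldType) (p : {poly C}) : Prop :=
  forall z, root p z -> `|z| < 1.

Lemma norm_horner_monic (C : numClosedFieldType) (p : {poly C}) :
  p \is monic ->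
  exists2 s : seq C, (size s).+1 = size p &
    (forall z, root p z = (z \in s)) /\
    (forall z, `|p.[z]| = \prod_(x <- s) `|z - x|).
Proof.
move=> mp; have [s] := closed_field_poly_normal p.
rewrite (monicP mp) scale1r => ps; exists s.
  by rewrite ps size_prod_XsubC.
split=> z; first by rewrite ps root_prod_XsubC.
rewrite ps horner_prod normr_prod; apply: eq_bigr => x _.
by rewrite hornerXsubC.
Qed.

Lemma norm_horner_le (C : numClosedFieldType) (q : {poly C}) (m : nat) (z : C) :
  (size q <= m.+1)%N -> 1 <= `|z| ->
  `|q.[z]| <= (\sum_(k < m.+1) `|q`_k|) * `|z| ^+ m.
Proof.
move=> sq z1; rewrite (horner_coef_wide _ sq) mulr_suml.
apply: le_trans (ler_norm_sum _ _ _) _; apply: ler_sum => k _.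
rewrite normrM normrX ler_wpM2l //.
by apply: ler_weXn2l => //; rewrite -ltnS.
Qed.

(** For [|z| >= 1] every root [x] of [p] satisfies [|z - x| >= |z| (1 - |x|)]. Hence
    [|p(z)| >= d |z|^m] with [m] the degree of [p], and for small [t] this outweighs
    [|t q(z)| <= |t| K |z|^m] uniformly in [z]. *)
Lemma poly_schur_open (C : numClosedFieldType) (p q : {poly C}) :
  p \is monic -> (size q < size p)%N -> poly_schur p ->
  exists2 e : C, 0 < e &
    forall t : C, `|t| < e -> poly_schur (p + t *: q).
Proof.
move=> mp sq stp; have [s sp [rs ns]] := norm_horner_monic mp.
pose d := \prod_(x <- s) (1 - `|x|).
have d0 : 0 < d.
  rewrite /d big_seq_cond; apply: prodr_gt0 => x; rewrite andbT => xs.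
  by rewrite subr_gt0 stp // rs.
pose K := \sum_(k < (size s).+1) `|q`_k|.
have K0 : 0 <= K by apply: sumr_ge0.
(* The added 1 keeps the radius [d / (K + 1)] meaningful when [q = 0]. *)
have K1 : 0 < K + 1 by rewrite ltr_wpDl.
exists (d / (K + 1)); first by rewrite divr_gt0.
move=> t; rewrite ltr_pdivlMr // => te z.
rewrite rootE hornerD hornerZ addr_eq0 => /eqP pz.
rewrite real_ltNge ?normr_real ?real1 //; apply/negP => z1.
have lo : d * `|z| ^+ size s <= `|p.[z]|.
  rewrite ns /d -prodr_const_seq -big_split /=.
  rewrite big_seq_cond [leRHS]big_seq_cond.
  apply: ler_prod => x; rewrite andbT => xs.
  have x1 : `|x| < 1 by rewrite stp // rs.
  rewrite mulr_ge0 ?subr_ge0 ?(ltW x1) //=.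
  apply: le_trans (lerB_dist _ _); rewrite mulrBl mul1r lerD2l lerN2.
  by rewrite ler_peMr.
have hi : `|p.[z]| <= `|t| * (K * `|z| ^+ size s).
  rewrite pz normrN normrM ler_wpM2l // norm_horner_le //.
  by rewrite sp (leq_trans _ sq).
have zn : 0 < `|z| ^+ size s by rewrite exprn_gt0 // (lt_le_trans ltr01).
have := le_trans lo hi; rewrite mulrA ler_pM2r // => dl.
have tK : `|t| * K <= `|t| * (K + 1) by rewrite ler_wpM2l // lerDl.
by have := le_lt_trans dl (le_lt_trans tK te); rewrite ltxx.
Qed.

(** All [x] in the unit disk satisfy [|z0 - x| >= |z0| - 1], so a Schur [p + t q] of degree [n] has
    modulus at least [(|z0| - 1)^n] at [z0]. Its value there is only [t q(z0)]. *)
Lemma poly_outer_root_open (C : numClosedFieldType) (p q : {poly C}) (z0 : C) :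
  p \is monic -> (size q < size p)%N -> root p z0 -> 1 < `|z0| ->
  exists2 e : C, 0 < e & forall t : C, `|t| < e -> ~ poly_schur (p + t *: q).
Proof.
move=> mp sq /eqP pz z1.
have q1 : 0 < `|q.[z0]| + 1 by rewrite ltr_wpDl.
have e0 : 0 < `|z0| - 1 by rewrite subr_gt0.
pose n := (size p).-1.
exists ((`|z0| - 1) ^+ n / (`|q.[z0]| + 1)); first by rewrite divr_gt0 ?exprn_gt0.
move=> t; rewrite ltr_pdivlMr // => te stpt.
have stq : (size (t *: q)%R < size p)%N by rewrite (leq_ltn_trans (size_scale_leq _ _)).
have mt : p + t *: q \is monic by rewrite monicE lead_coefDl // -monicE.
have [s sp [rs ns]] := norm_horner_monic mt.
have ss : size s = n by rewrite /n -(size_polyDl stq) -sp.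
have : (`|z0| - 1) ^+ n <= `|(p + t *: q).[z0]|.
  rewrite ns -ss -prodr_const_seq.
  rewrite big_seq_cond [leRHS]big_seq_cond; apply: ler_prod => x.
  rewrite andbT => xs; rewrite (ltW e0) /=.
  apply: le_trans (lerB_dist _ _); rewrite lerD2l lerN2 ltW //.
  by rewrite stpt // rs.
rewrite hornerD pz add0r hornerZ normrM => lo.
have tq : `|t| * `|q.[z0]| <= `|t| * (`|q.[z0]| + 1) by rewrite ler_wpM2l // lerDl.
by have := le_lt_trans lo (le_lt_trans tq te); rewrite ltxx.
Qed.

Lemma gt0_complexE (R : rcfType) (e : R[i]) : 0 < e -> exists2 r : R, 0 < r & e = r%:C%C.
Proof.
by case: e => a b; rewrite ltcE /= => /andP[/eqP-> a0]; exists a.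
Qed.

Lemma norm_real_complex (R : rcfType) (x : R) : `|x%:C%C| = `|x|%:C%C :> R[i].
Proof. by rewrite normc_def /= expr0n addr0 sqrtr_sqr. Qed.

(** A supremum argument on [[0, 1]] that never follows individual roots: both stability and the
    presence of a root of modulus above 1 are open in [t]. *)
Lemma poly_schur_crossing (R : realType) (p q : {poly R[i]}) :
  p \is monic -> (size q < size p)%N -> poly_schur p ->
  (forall (t : R) z, 0 <= t <= 1 -> `|z| = 1 -> ~~ root (p + t%:C%C *: q) z) ->
  forall t : R, 0 <= t <= 1 -> poly_schur (p + t%:C%C *: q).
Proof.
move=> mp sq stp ncross.
pose f (t : R) := p + t%:C%C *: q.
have mf t : f t \is monic.
  by rewrite monicE lead_coefDl -?monicE // (leq_ltn_trans (size_scale_leq _ _)).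
have sf t : (size q < size (f t))%N.
  by rewrite size_polyDl // (leq_ltn_trans (size_scale_leq _ _)).
have shift t h : f t + (h%:C)%C *: q = f (t + h).
  by rewrite /f -addrA -scalerDl rmorphD.
pose T : set R := [set t | 0 <= t <= 1 /\
  forall s, 0 <= s <= t -> poly_schur (f s)]%classic.
have T0 : T 0.
  split=> [|s /andP[s0 s1]]; first by rewrite lexx ler01.
  have -> : s = 0 by apply/eqP; rewrite eq_le s0 s1.
  by rewrite /f rmorph0 scale0r addr0.
have supT : has_sup T by split; [exists 0 | exists 1 => t [/andP[]]].
pose tau := sup T.
have tau01 : 0 <= tau <= 1.
  apply/andP; split; first exact: (ub_le_sup (proj2 supT)).
  by apply: ge_sup (proj1 supT) _ => t [/andP[]].
have nearT e : 0 < e -> exists2 t, T t & tau - e < t <= tau.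
  move=> e0; have [t Tt te] := sup_adherent e0 supT.
  by exists t => //; rewrite te (ub_le_sup (proj2 supT)).
(* A root of modulus above 1 at [tau] would persist at nearby parameters [t <= tau] of [T]; modulus
   1 is excluded by hypothesis. *)
have stau : poly_schur (f tau).
  move=> z rz; rewrite real_ltNge ?normr_real ?real1 //; apply/negP => z1.
  have {z1} z1 : 1 < `|z|.
    rewrite lt_def z1 andbT; apply/eqP => zE.
    by move: (ncross _ _ tau01 zE); rewrite rz.
  have [e /gt0_complexE[r r0 ->] ne] := poly_outer_root_open (mf _) (sf _) rz z1.
  have [t [t01 Tt] /andP[t1 t2]] := nearT _ r0.
  apply: (ne (t - tau)%:C%C); last first.
    by rewrite shift addrC subrK; apply: Tt; rewrite lexx andbT; case/andP: t01.
  by rewrite norm_real_complex ltcR ltr_norml; apply/andP; split; lra.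
have [e /gt0_complexE[r r0 ->] ne] := poly_schur_open (mf _) (sf _) stau.
have [t [t01 Tt] /andP[t1 t2]] := nearT _ r0.
have ext s : 0 <= s -> s < tau + r -> poly_schur (f s).
  move=> s0 sr; have [st|ts] := lerP s t; first by apply: Tt; rewrite s0.
  rewrite -[s](subrK tau) addrC -shift; apply: ne.
  by rewrite norm_real_complex ltcR ltr_norml; apply/andP; split; lra.
(* Stability extends beyond [tau] by [r], so [tau < 1] would contradict the supremum. *)
have tau1 : tau = 1.
  apply/eqP; rewrite eq_le; case/andP: (tau01) => tau0 ->.
  have [//|lt1] := lerP 1 tau.
  pose s := Num.min 1 (tau + r / 2).
  have sE : tau < s by rewrite lt_min lt1 /=; lra.
  have Ts : T s.
    split; first by rewrite ge_min lexx andbT; lra.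
    move=> x /andP[x0]; rewrite le_min => /andP[_ xs]; apply: ext => //; lra.
  by have := ub_le_sup (proj2 supT) Ts; rewrite -/tau leNgt sE.
by move=> s /andP[s0 s1]; apply: ext => //; rewrite tau1; lra.
Qed.

(** * Triangles of polynomials on the unit circle *)

Definition cabs (R : rcfType) (z : R[i]) : R :=
  Num.sqrt (complex.Re z ^+ 2 + complex.Im z ^+ 2).

Definition cdot (R : rcfType) (z w : R[i]) : R :=
  complex.Re z * complex.Re w + complex.Im z * complex.Im w.

(* For [x], [y], [z] of modulus 1 this is [(`|x + y + z| ^+ 2 - 1) / 2], which
   vanishes only if two of the three are opposite (see [tri_angle_prod]). *)
Definition tri_angle (R : rcfType) (x y z : R[i]) : R :=
  cabs x * cabs y * cabs z
  + cdot x y * cabs z + cdot y z * cabs x + cdot z x * cabs y.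

Lemma norm_cabs (R : rcfType) (z : R[i]) : `|z| = (cabs z)%:C%C.
Proof. exact: normc_def. Qed.

Lemma cabs_sqr (R : rcfType) (z : R[i]) :
  cabs z ^+ 2 = complex.Re z ^+ 2 + complex.Im z ^+ 2.
Proof. by rewrite sqr_sqrtr // addr_ge0 ?sqr_ge0. Qed.

(** For unit [x], [y], [z] one has [xy + yz + zx = xyz conj(x + y + z)], so [(x + y)(y + z)(z + x) =
    (x + y + z)(xy + yz + zx) - xyz] is [xyz (|x + y + z|^2 - 1)]. The moduli make this homogeneous.
    A factor vanishes, for nonzero arguments, exactly when two of them are opposite in direction. *)
Lemma tri_angle_prod (R : rcfType) (x y z : R[i]) :
  (`|y| * x + `|x| * y) * (`|z| * y + `|y| * z) * (`|x| * z + `|z| * x)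
  = (2 * tri_angle x y z)%:C%C * (x * y * z).
Proof.
rewrite !norm_cabs /tri_angle /cdot.
have := cabs_sqr x; have := cabs_sqr y; have := cabs_sqr z.
move: (cabs x) (cabs y) (cabs z).
case: x => x1 x2; case: y => y1 y2; case: z => z1 z2 a b c /= hc hb ha.
apply/eqP; rewrite eq_complex /=; apply/andP; split; apply/eqP; ring: ha hb hc.
Qed.

(* With [z = - (a x + b y)], the left-hand side of the inequality factors as
   [(|x| |y| + <x, y>) (|z| - a |x| - b |y|)]. *)
Lemma tri_angle_cone_le0 (R : rcfType) (x y : R[i]) (a b : R) :
  0 <= a -> 0 <= b -> tri_angle x y (- (a%:C%C * x + b%:C%C * y)) <= 0.
Proof.
move=> a0 b0; set z := - _.
have x0 : 0 <= cabs x by apply: sqrtr_ge0.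
have y0 : 0 <= cabs y by apply: sqrtr_ge0.
have xy0 : 0 <= cabs x * cabs y + cdot x y.
  have : cdot x y ^+ 2 <= (cabs x * cabs y) ^+ 2.
    rewrite exprMn !cabs_sqr -subr_ge0 /cdot.
    rewrite (_ : _ - _ = (complex.Re x * complex.Im y - complex.Im x * complex.Re y) ^+ 2).
      exact: sqr_ge0.
    by ring.
  rewrite -(real_normK (num_real (cdot x y))) ler_sqr ?nnegrE ?mulr_ge0 //.
  by rewrite ler_norml => /andP[+ _]; rewrite -subr_ge0 opprK addrC.
have zn : cabs z <= a * cabs x + b * cabs y.
  rewrite -lecR -norm_cabs normrN rmorphD !rmorphM /=.
  apply: le_trans (ler_normD _ _) _.
  by rewrite !normrM !norm_real_complex (ger0_norm a0) (ger0_norm b0) !norm_cabs.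
have -> : tri_angle x y z
  = (cabs x * cabs y + cdot x y) * (cabs z - (a * cabs x + b * cabs y)).
  rewrite /tri_angle; move: (cabs z) => c.
  have := cabs_sqr x; have := cabs_sqr y; move: (cabs x) (cabs y).
  rewrite /z /cdot; case: (x) => x1 x2; case: (y) => y1 y2 /= d e hy hx.
  ring: hx hy.
by rewrite mulr_ge0_le0 // subr_le0.
Qed.

Lemma tri_angleC (R : rcfType) (x y z : R[i]) : tri_angle x y z = tri_angle y z x.
Proof. by rewrite /tri_angle; ring. Qed.

Lemma cabsZ (R : rcfType) (a : R) (z : R[i]) : 0 <= a -> cabs (a%:C%C * z) = a * cabs z.
Proof.
move=> a0; apply: (@complexI R).
by rewrite -norm_cabs normrM norm_real_complex (ger0_norm a0) norm_cabs rmorphM.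
Qed.

Lemma tri_angleZ (R : rcfType) (a : R) (x y z : R[i]) : 0 <= a ->
  tri_angle x y (a%:C%C * z) = a * tri_angle x y z.
Proof.
move=> a0; rewrite /tri_angle cabsZ // /cdot.
by case: x y z => [x1 x2] [y1 y2] [z1 z2] /=; ring.
Qed.

Lemma tri_angle_hull_le0 (R : rcfType) (x y z : R[i]) (a b c : R) :
  0 <= a -> 0 <= b -> 0 < c ->
  a%:C%C * x + b%:C%C * y + c%:C%C * z = 0 -> tri_angle x y z <= 0.
Proof.
move=> a0 b0 c0 E; rewrite -(pmulr_rle0 _ c0) -tri_angleZ ?(ltW c0) //.
move/eqP: E; rewrite addrC addr_eq0 => /eqP ->.
exact: tri_angle_cone_le0.
Qed.

(** For nonzero reals with signs [s1], [s2], [s3] the value is [|xyz| (1 + s1 s2 + s2 s3 + s3 s1)]: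
    it is [4 |xyz|] when the signs agree and 0 otherwise. *)
Lemma tri_angle_real_ge0 (R : rcfType) (x y z : R) :
  0 <= tri_angle x%:C%C y%:C%C z%:C%C.
Proof.
rewrite /tri_angle /cdot /cabs /= !expr0n !addr0 !sqrtr_sqr !mulr0 !addr0.
have [x0|x0] := lerP 0 x; have [y0|y0] := lerP 0 y; have [z0|z0] := lerP 0 z;
  rewrite ?(ger0_norm x0) ?(ltr0_norm x0) ?(ger0_norm y0) ?(ltr0_norm y0)
    ?(ger0_norm z0) ?(ltr0_norm z0); last 1 first.
- have : 0 <= - x * - y * - z by rewrite !mulr_ge0 // oppr_ge0 ltW.
  lra.
- have : 0 <= x * y * z by rewrite !mulr_ge0.
  lra.
all: lra.
Qed.

Lemma continuous_addfun (R : realType) (f g : R -> R) :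
  continuous f -> continuous g -> continuous (fun s => f s + g s).
Proof. by move=> cf cg s; apply: cvgD; [apply: cf | apply: cg]. Qed.

Lemma continuous_mulfun (R : realType) (f g : R -> R) :
  continuous f -> continuous g -> continuous (fun s => f s * g s).
Proof. by move=> cf cg s; apply: cvgM; [apply: cf | apply: cg]. Qed.

Lemma continuous_sqrtfun (R : realType) (f : R -> R) :
  continuous f -> continuous (fun s => Num.sqrt (f s)).
Proof.
by move=> cf s; apply: (continuous_comp (cf s)); exact: sqrt_continuous.
Qed.

Lemma continuous_horner_complex (R : realType) (p : {poly R[i]}) (u v : R -> R) :
  continuous u -> continuous v ->
  continuous (fun s : R => complex.Re p.[u s +i* v s]%C : R) /\
  continuous (fun s : R => complex.Im p.[u s +i* v s]%C : R).
Proof.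
move=> cu cv; elim/poly_ind: p => [|p c [cR cI]].
  by split=> s /=; under eq_fun do rewrite horner0 /=; exact: cst_continuous.
(* Writing the subtraction as a product with -1 leaves only sums and products of continuous
   functions. *)
have hE s : p.[u s +i* v s]%C * (u s +i* v s)%C + c
    = Complex (complex.Re p.[u s +i* v s]%C * u s
               + complex.Im p.[u s +i* v s]%C * (-1 * v s) + complex.Re c)
              (complex.Re p.[u s +i* v s]%C * v s + complex.Im p.[u s +i* v s]%C * u s
               + complex.Im c).
  rewrite mulN1r mulrN; by case: (p.[_]) => a b; case: (c).
have cst (x : R) : continuous (fun _ : R => x) by exact: cst_continuous.
split; under eq_fun do rewrite hornerMXaddC hE /=.
  do !apply: continuous_addfun => //; apply: continuous_mulfun => //.
  exact: continuous_mulfun.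
by do !apply: continuous_addfun => //; apply: continuous_mulfun.
Qed.

Lemma continuous_tri_angle (R : realType) (p q r : {poly R[i]}) (u v : R -> R) :
  continuous u -> continuous v ->
  continuous (fun s : R =>
    tri_angle p.[u s +i* v s]%C q.[u s +i* v s]%C r.[u s +i* v s]%C : R).
Proof.
move=> cu cv.
have [cp1 cp2] := continuous_horner_complex p cu cv.
have [cq1 cq2] := continuous_horner_complex q cu cv.
have [cr1 cr2] := continuous_horner_complex r cu cv.
have cabsC (f g : R -> R) : continuous f -> continuous g ->
    continuous (fun s => cabs (f s +i* g s)%C).
  move=> cf cg; rewrite /cabs /=.
  by apply: continuous_sqrtfun; apply: continuous_addfun; apply: continuous_mulfun.
rewrite /tri_angle /cdot.
apply: continuous_addfun; [apply: continuous_addfun; [apply: continuous_addfun|]|].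
- apply: continuous_mulfun; last exact: (cabsC _ _ cr1 cr2).
  apply: continuous_mulfun; first exact: (cabsC _ _ cp1 cp2).
  exact: (cabsC _ _ cq1 cq2).
- apply: continuous_mulfun; last exact: (cabsC _ _ cr1 cr2).
  by apply: continuous_addfun; apply: continuous_mulfun.
- apply: continuous_mulfun; last exact: (cabsC _ _ cp1 cp2).
  by apply: continuous_addfun; apply: continuous_mulfun.
- apply: continuous_mulfun; last exact: (cabsC _ _ cq1 cq2).
  by apply: continuous_addfun; apply: continuous_mulfun.
Qed.

(* As [z] moves along the unit circle to [1], [tri_angle p(z) q(z) r(z)] can
   only vanish where two of the three values are opposite in direction; it is
   nonnegative at the real point [1], and nonpositive where the triangle
   contains [0]. *)
Lemma circle_triangle (R : realType) (p q r : {poly R}) :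
  let ev (f : {poly R}) (z : R[i]) : R[i] := (map_poly (real_complex R) f).[z] in
  let avoids0 (f g : {poly R}) := forall z : R[i], `|z| = 1 ->
     forall a b : R, 0 <= a -> 0 <= b -> 0 < a + b ->
     a%:C%C * ev f z + b%:C%C * ev g z != 0 in
  avoids0 p q -> avoids0 q r -> avoids0 r p ->
  forall z : R[i], `|z| = 1 ->
  forall a b c : R, 0 <= a -> 0 <= b -> 0 <= c -> 0 < a + b + c ->
  a%:C%C * ev p z + b%:C%C * ev q z + c%:C%C * ev r z != 0.
Proof.
move=> ev avoids0 pq qr rp z0 z01 a b c a0 b0 c0 abc; apply/eqP => E.
have nz f g : avoids0 f g -> forall z : R[i], `|z| = 1 -> ev f z != 0 /\ ev g z != 0.
  move=> fg z z1; split.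
    have := fg z z1 1 0; rewrite rmorph1 rmorph0 mul1r mul0r !addr0; apply => //; lra.
  have := fg z z1 0 1; rewrite rmorph1 rmorph0 mul1r mul0r !add0r; apply => //; lra.
(* The weights [|g(z)|] and [|f(z)|] in [avoids0] exclude opposite directions, that is, they make
   each factor in [tri_angle_prod] nonzero. *)
have opp f g : avoids0 f g -> forall z : R[i], `|z| = 1 ->
    `|ev g z| * ev f z + `|ev f z| * ev g z != 0.
  move=> fg z z1; rewrite !norm_cabs; have [fz gz] := nz _ _ fg z z1.
  have cg0 : 0 < cabs (ev g z) by rewrite -ltcR -norm_cabs normr_gt0.
  have cf0 : 0 < cabs (ev f z) by rewrite -ltcR -norm_cabs normr_gt0.
  by apply: fg => //; lra.
have G0 z : `|z| = 1 -> tri_angle (ev p z) (ev q z) (ev r z) != 0.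
  move=> z1; apply/eqP => G; have := tri_angle_prod (ev p z) (ev q z) (ev r z).
  move/eqP; rewrite G mulr0 mul0r !mulf_eq0.
  by rewrite !(negPf (opp _ _ _ _ _)).
(* Some weight is positive; a cyclic rotation brings its polynomial into the last place. *)
have Gz0 : tri_angle (ev p z0) (ev q z0) (ev r z0) <= 0.
  have [c1|c1] := ltrP 0 c; first exact: tri_angle_hull_le0 E.
  have [a1|a1] := ltrP 0 a.
    rewrite tri_angleC; apply: (@tri_angle_hull_le0 _ _ _ _ b c a) => //.
    by rewrite -E addrC addrA.
  have [b1|b1] := ltrP 0 b.
    rewrite 2!tri_angleC; apply: (@tri_angle_hull_le0 _ _ _ _ c a b) => //.
    by rewrite -E -addrA addrC.
  lra.
(* The arc from [z0] to 1 is parametrized by its real part [s], running from [x0] to 1; [sg] selects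
   the half circle that contains [z0]. *)
pose x0 := complex.Re z0; pose sg : R := if complex.Im z0 < 0 then -1 else 1.
have sg2 : sg ^+ 2 = 1 by rewrite /sg; case: ifP => _; ring.
have z0n : x0 ^+ 2 + complex.Im z0 ^+ 2 = 1.
  rewrite -cabs_sqr (_ : cabs z0 = 1) ?expr1n //.
  by apply: (@complexI R); rewrite -norm_cabs z01.
pose v (s : R) : R := sg * Num.sqrt (1 + -1 * (s * s)).
have cid : continuous (fun x : R => x) by move=> x; exact: cvg_id.
have cv : continuous v.
  have cst (x : R) : continuous (fun _ : R => x) by exact: cst_continuous.
  apply: (continuous_mulfun (cst sg)); apply: continuous_sqrtfun.
  apply: (continuous_addfun (cst 1)); apply: (continuous_mulfun (cst (-1))).
  exact: continuous_mulfun.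
pose G (s : R) : R := tri_angle (ev p (s +i* v s)%C) (ev q (s +i* v s)%C) (ev r (s +i* v s)%C).
have cG : continuous G.
  exact: (continuous_tri_angle cid cv).
have x01 : -1 <= x0 <= 1.
  by have := sqr_ge0 (complex.Im z0); move: z0n; move: (complex.Im z0) (x0) => y x; nra.
have circ s : x0 <= s <= 1 -> `|(s +i* v s)%C| = 1.
  move=> /andP[s0 s1]; rewrite norm_cabs /cabs /= /v exprMn sg2 mul1r.
  rewrite sqr_sqrtr; last by case/andP: x01 => ? ?; nra.
  have -> : s ^+ 2 + (1 + -1 * (s * s)) = 1 by ring.
  by rewrite sqrtr1.
have Gx0 : G x0 <= 0.
  rewrite /G (_ : (x0 +i* v x0)%C = z0) //.
  rewrite [RHS](_ : z0 = (x0 +i* complex.Im z0)%C); last by rewrite /x0; case: (z0).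
  congr Complex; rewrite /v (_ : 1 + _ = complex.Im z0 ^+ 2); last first.
    by move: z0n; rewrite expr2; lra.
  rewrite sqrtr_sqr /sg; case: ltP => [h|h].
    by rewrite ltr0_norm // mulN1r opprK.
  by rewrite ger0_norm // mul1r.
have G1 : 0 <= G 1.
  rewrite /G /v mulr1 mulr1 addrN sqrtr0 mulr0.
  by rewrite /ev !horner_map tri_angle_real_ge0.
case/andP: (x01) => _ xle.
have [] := @IVT R G x0 1 0 xle.
- exact: continuous_subspaceT.
- by rewrite ge_min Gx0 le_max G1 orbT.
move=> s; rewrite in_itv /= => /circ sc Gs.
by have := G0 _ sc; rewrite -/(G s) Gs eqxx.
Qed.

(** * Segments, triangles and convex hulls of matrices *)

(** Block elimination confines [v] to a single row of a larger matrix, where multilinearity of the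
    determinant applies. *)
Lemma det_dyad_block (S : comNzRingType) (n : nat) (K : 'M[S]_n)
    (u : 'cV[S]_n) (v : 'rV[S]_n) :
  \det (K + u *m v) = \det (block_mx (1%:M : 'M_1) v (- u) K).
Proof.
have E : block_mx (1%:M : 'M_1) 0 u 1%:M *m block_mx (1%:M : 'M_1) v (- u) K
         = block_mx (1%:M : 'M_1) v 0 (K + u *m v).
  by rewrite mulmx_block !mul1mx !mul0mx !addr0 !mulmx1 addrN addrC.
have := congr1 determinant E.
by rewrite det_mulmx det_lblock det_ublock !det1 !mul1r.
Qed.

Lemma det_dyad_affine (S : comNzRingType) (n : nat) (K : 'M[S]_n)
    (u : 'cV[S]_n) (v : 'rV[S]_n) (t : S) :
  \det (K + u *m (t *: v)) = (1 - t) * \det K + t * \det (K + u *m v).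
Proof.
have E0 : \det K = \det (block_mx (1%:M : 'M_1) 0 (- u) K).
  by rewrite -det_dyad_block mulmx0 addr0.
rewrite !det_dyad_block E0 /block_mx.
(* Only the top row depends on [t], and [(1, t v) = (1 - t) (1, 0) + t (1, v)]. *)
apply: (@determinant_multilinear _ _ _ _ _ (lshift n 0)).
- rewrite !rowKu !row_id !scale_row_mx add_row_mx scaler0 add0r.
  by rewrite -scalerDl subrK scale1r.
- by rewrite !row'Ku [row' 0 (row_mx _ 0)]flatmx0 [row' 0 (row_mx _ (t *: v))]flatmx0.
- by rewrite !row'Ku [row' 0 (row_mx _ v)]flatmx0 [row' 0 (row_mx _ (t *: v))]flatmx0.
Qed.

Lemma char_poly_dyad_affine (F : fieldType) (n : nat) (M M' : 'M[F]_n)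
    (u : 'cV[F]_n) (v : 'rV[F]_n) (t : F) : M' - M = u *m v ->
  char_poly ((1 - t) *: M + t *: M')
  = (1 - t) *: char_poly M + t *: char_poly M'.
Proof.
move=> /(canRL (subrK _)) ->; set U := map_mx polyC (- u); set V := map_mx polyC v.
have cE (s : F) : char_poly_mx ((1 - s) *: M + s *: (u *m v + M))
     = char_poly_mx M + U *m (s%:P *: V).
  rewrite /char_poly_mx scalerDr scalerBl scale1r addrCA subrK !map_mxD.
  by rewrite opprD addrAC -scalemxAr /U map_mxN mulNmx map_mxZ map_mxM scalerN addrA addrAC.
rewrite /char_poly cE det_dyad_affine.
have -> : char_poly_mx (u *m v + M) = char_poly_mx M + U *m V.
  by have := cE 1; rewrite subrr scale0r add0r !scale1r.
by rewrite -!mul_polyC rmorphB.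
Qed.

Lemma schur_stable_char_poly (R : realType) (n : nat) (M : 'M[R]_n) :
  schur_stable M <-> poly_schur (map_poly (real_complex R) (char_poly M)).
Proof.
by rewrite /schur_stable /poly_schur; split=> st z;
  have := st z; rewrite eigenvalue_root_char map_char_poly.
Qed.

Definition dyadic (F : fieldType) (n : nat) (D : 'M[F]_n) : Prop :=
  exists (u : 'cV[F]_n) (v : 'rV[F]_n), D = u *m v.

Definition segment (F : fieldType) (n : nat) (M M' : 'M[F]_n) (t : F) : 'M[F]_n :=
  (1 - t) *: M + t *: M'.

Definition stable_segment (R : realType) (n : nat) (M M' : 'M[R]_n) : Prop :=
  forall t, 0 <= t <= 1 -> schur_stable (segment M M' t).

Lemma segmentC (F : fieldType) (n : nat) (M M' : 'M[F]_n) (t : F) :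
  segment M M' t = segment M' M (1 - t).
Proof. by rewrite /segment subKr addrC. Qed.

Lemma segment0 (F : fieldType) (n : nat) (M M' : 'M[F]_n) : segment M M' 0 = M.
Proof. by rewrite /segment subr0 scale1r scale0r addr0. Qed.

Lemma segmentE (F : fieldType) (n : nat) (M M' : 'M[F]_n) (t : F) :
  segment M M' t = M + t *: (M' - M).
Proof.
by rewrite /segment scalerBl scale1r scalerBr -!addrA; congr (_ + _); rewrite addrC.
Qed.

Lemma char_poly_segment (F : fieldType) (n : nat) (M M' : 'M[F]_n) (t : F) :
  dyadic (M' - M) ->
  char_poly (segment M M' t) = (1 - t) *: char_poly M + t *: char_poly M'.
Proof. by case=> u [v]; exact: char_poly_dyad_affine. Qed.

Lemma stable_segment_sym (R : realType) (n : nat) (M M' : 'M[R]_n) :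
  stable_segment M M' -> stable_segment M' M.
Proof. by move=> st t t01; rewrite segmentC; apply: st; lra. Qed.

Lemma stable_segment_refl (R : realType) (n : nat) (M : 'M[R]_n) :
  schur_stable M -> stable_segment M M.
Proof. by move=> st t _; rewrite segmentE subrr scaler0 addr0. Qed.

Lemma horner_map_lin2 (F K : fieldType) (f : {rmorphism F -> K}) (a b : F)
    (p q : {poly F}) (z : K) :
  (map_poly f (a *: p + b *: q)).[z]
  = f a * (map_poly f p).[z] + f b * (map_poly f q).[z].
Proof. by rewrite rmorphD /= !map_polyZ hornerD !hornerZ. Qed.

Lemma size_monicB (S : nzRingType) (p q : {poly S}) : p \is monic -> q \is monic ->
  size p = size q -> (size (q - p)%R < size p)%N.
Proof.
move=> mp mq e; have p0 : (0 < size p)%N by rewrite size_poly_gt0 monic_neq0.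
rewrite -(prednK p0) ltnS; apply/leq_sizeP => i; rewrite leq_eqVlt => /orP[/eqP<-|lt].
  by rewrite coefB {1}e -/(lead_coef q) -/(lead_coef p) (monicP mp) (monicP mq) subrr.
by rewrite coefB !nth_default ?subrr // -?e -(prednK p0).
Qed.

(** The characteristic polynomial is affine in [t], and its direction is a difference of monic
    polynomials of equal size, hence of lower degree, as [poly_schur_crossing] requires. *)
Lemma stable_segment_crossing (R : realType) (n : nat) (M M' : 'M[R]_n) :
  dyadic (M' - M) -> schur_stable M ->
  (forall (t : R) (z : R[i]), 0 <= t <= 1 -> `|z| = 1 ->
     ~~ eigenvalue (map_mx (real_complex R) (segment M M' t)) z) ->
  stable_segment M M'.
Proof.
move=> dy stM nc; pose f := map_poly (real_complex R).
have fE (t : R) : f (char_poly (segment M M' t))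
    = f (char_poly M) + t%:C%C *: (f (char_poly M') - f (char_poly M)).
  rewrite char_poly_segment // /f rmorphD /= !map_polyZ /= rmorphB rmorph1.
  by rewrite scalerBl scale1r scalerBr -!addrA; congr (_ + _); rewrite addrC.
move=> t t01; apply/schur_stable_char_poly; rewrite -/f fE.
apply: poly_schur_crossing => //.
- by rewrite /f map_char_poly char_poly_monic.
- by rewrite /f !map_char_poly; apply: size_monicB; rewrite ?char_poly_monic ?size_char_poly.
- exact/schur_stable_char_poly.
move=> s z s01 z1; rewrite -fE /f map_char_poly -eigenvalue_root_char.
exact: nc.
Qed.

(** [S] is a convex class in which any two members differ by a dyad, so characteristic polynomials
    are affine along all segments within it. A unit-modulus eigenvalue inside the triangle is then
    excluded by [circle_triangle]. *)
Lemma stable_triangle (R : realType) (n : nat) (S : 'M[R]_n -> Prop)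
    (M1 M2 M3 : 'M[R]_n) :
  (forall M M', S M -> S M' -> dyadic (M' - M)) ->
  (forall M M' t, S M -> S M' -> 0 <= t <= 1 -> S (segment M M' t)) ->
  S M1 -> S M2 -> S M3 ->
  stable_segment M1 M2 -> stable_segment M2 M3 -> stable_segment M3 M1 ->
  forall s, 0 <= s <= 1 -> stable_segment M1 (segment M2 M3 s).
Proof.
move=> dyS cvS S1 S2 S3 st12 st23 st31 s s01.
apply: stable_segment_crossing; first by apply: dyS; auto.
  by have := st12 0; rewrite segment0; apply; rewrite lexx ler01.
move=> t z t01 z1; rewrite eigenvalue_root_char -map_char_poly.
rewrite !char_poly_segment; [|by auto|by apply: dyS; auto].
have ev2 M M' : S M -> S M' -> stable_segment M M' -> forall z : R[i], `|z| = 1 ->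
    forall a b : R, 0 <= a -> 0 <= b -> 0 < a + b ->
    a%:C%C * (map_poly (real_complex R) (char_poly M)).[z]
    + b%:C%C * (map_poly (real_complex R) (char_poly M')).[z] != 0.
  move=> SM SM' st x x1 a b a0 b0 ab; apply/eqP => E.
  (* After division by [a + b], a vanishing combination is a unit-modulus eigenvalue on the edge at
     parameter [b / (a + b)]. *)
  have r01 : 0 <= b / (a + b) <= 1.
    by rewrite divr_ge0 ?addr_ge0 //= ler_pdivrMr // mul1r lerDr.
  have /schur_stable_char_poly/(_ x) := st _ r01; rewrite x1 ltxx => H.
  suff : false by []; apply: H; rewrite char_poly_segment; last exact: dyS.
  rewrite rootE (horner_map_lin2 (real_complex R)).
  have -> : 1 - b / (a + b) = a / (a + b) by field; lra.
  by rewrite !(mulrC _ (a + b)^-1) !rmorphM -!mulrA -mulrDr E mulr0 eqxx.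
have := circle_triangle (ev2 _ _ S1 S2 st12) (ev2 _ _ S2 S3 st23) (ev2 _ _ S3 S1 st31) z1.
(* These are the barycentric coordinates of the point at parameter [t] from [M1] to
   [segment M2 M3 s]. *)
move=> /(_ (1 - t) (t * (1 - s)) (t * s)).
have -> : 1 - t + t * (1 - s) + t * s = 1 by ring.
move: t01 s01 => /andP[t0 t1] /andP[s0 s1].
rewrite !subr_ge0 !mulr_ge0 ?subr_ge0 // ltr01 => /(_ t1 isT isT isT).
rewrite rootE !(horner_map_lin2 (real_complex R)).
by rewrite !rmorphM mulrDr !mulrA addrA.
Qed.

(** Split off the first vertex and renormalize the others by their total weight [s = 1 - w i]. If
    [s = 0], the remaining terms vanish and the point is [A i]. *)
Lemma conv_hull_ind (R : realType) (n N : nat) (A : 'I_N -> 'M[R]_n) (P : 'M[R]_n -> Prop) :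
  (forall i, P (A i)) ->
  (forall M i t, P M -> 0 <= t <= 1 -> P (segment (A i) M t)) ->
  forall M, in_conv_hull A M -> P M.
Proof.
move=> PA Pseg M [w [w0 w1 ->]].
elim: (index_enum _) w w0 w1 => [|i r IH] w w0.
  by rewrite big_nil => /esym/eqP; rewrite oner_eq0.
rewrite !big_cons => w1.
have s0 : 0 <= \sum_(j <- r) w j by apply: sumr_ge0.
have [sE|sn] := eqVneq (\sum_(j <- r) w j) 0.
  have wi : w i = 1 by rewrite -w1 sE addr0.
  have : \sum_(j <- r) w j *: A j = 0.
    move/eqP: sE; rewrite psumr_eq0 // => /allP sE.
    by rewrite big_seq big1 // => j /sE/eqP->; rewrite scale0r.
  by move=> ->; rewrite wi scale1r addr0.
set s := \sum_(j <- r) w j in w1 s0 sn *.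
have := IH (fun j => w j / s); rewrite -mulr_suml divff // => H.
have -> : w i *: A i + \sum_(j <- r) w j *: A j
          = segment (A i) (\sum_(j <- r) (w j / s) *: A j) s.
  rewrite /segment scaler_sumr -w1 addrK; congr (_ + _); apply: eq_bigr => j _.
  by rewrite scalerA mulrC divfK.
apply: Pseg; first by apply: H => // j; rewrite divr_ge0.
by rewrite s0 /= -w1 lerDr w0.
Qed.

Lemma conv_hull_stable (R : realType) (n N : nat) (A : 'I_N -> 'M[R]_n)
    (S : 'M[R]_n -> Prop) :
  (forall M M', S M -> S M' -> dyadic (M' - M)) ->
  (forall M M' t, S M -> S M' -> 0 <= t <= 1 -> S (segment M M' t)) ->
  (forall i, S (A i)) -> (forall i j, stable_segment (A i) (A j)) ->
  forall M, in_conv_hull A M -> schur_stable M.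
Proof.
move=> dyS cvS SA stA M MA.
(* The invariant is strengthened: stable segments from [M] to all vertices supply the edges of the
   next triangle. *)
suff [] : S M /\ schur_stable M /\ forall j, stable_segment (A j) M by move=> _ [].
elim/conv_hull_ind: M / MA => [i|M i t [SM [stM segM]] t01].
  by split=> //; split=> //; have := stA i i 0; rewrite segment0; apply; rewrite lexx ler01.
split; first by auto.
split=> [|j]; first exact: segM.
exact: (stable_triangle dyS cvS (SA j) (SA i) SM (stA j i) (segM i)
  (stable_segment_sym (segM j))).
Qed.

(** * Bialternate products and alternating matrices *)

(** By Cayley-Hamilton a product of factors [M - z] annihilates [W] on the right. Each [W (M - z)]
    solves the same equation, so by induction [W M = z W]; then [W = z M^T W], and [1 - z M^T] is
    invertible. *)
Lemma stein_trivial (C : numClosedFieldType) (n : nat) (M W : 'M[C]_n) :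
  (forall z, eigenvalue M z -> `|z| < 1) -> M^T *m W *m M = W -> W = 0.
Proof.
case: n M W => [|n] M W st; first by rewrite !flatmx0.
have [r] := closed_field_poly_normal (char_poly M).
rewrite (monicP (char_poly_monic M)) scale1r => pM.
have str z : z \in r -> `|z| < 1.
  by move=> zr; apply: st; rewrite eigenvalue_root_char pM root_prod_XsubC.
(* A kernel vector would make [z^-1] an eigenvalue of [M], although [z] and [z^-1] cannot both have
   modulus below 1. *)
have unit z : z \in r -> 1%:M - z *: M^T \in unitmx.
  move=> /str z1; rewrite -unitmx_tr; apply/negPn/negP => nu.
  have /det0P[v v0] : \det (1%:M - z *: M^T)^T == 0.
    by move: nu; rewrite unitmxE unitfE negbK.
  rewrite linearB linearZ /= trmx1 trmxK mulmxBr mulmx1 -scalemxAr => /eqP.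
  rewrite subr_eq0 => /eqP vz.
  have z0 : z != 0 by apply: contraNneq v0 => z0; rewrite vz z0 scale0r.
  have : `|z^-1| < 1.
    by apply/st/eigenvalueP; exists v => //; rewrite {2}vz scalerA mulVf // scale1r.
  rewrite normfV invf_lt1 ?normr_gt0 // => /(lt_trans z1).
  by rewrite ltxx.
have : W *m horner_mx M (\prod_(z <- r) ('X - z%:P)) = 0.
  by rewrite -pM Cayley_Hamilton mulmx0.
elim: r W {pM str} unit => [|z r IH] W unit.
  by rewrite big_nil rmorph1 mulmx1.
rewrite big_cons rmorphM /= mulmxA rmorphB /= horner_mx_X horner_mx_C => h0 hW.
have WM : W *m (M - z%:M) = 0.
  apply: IH h0 _; first by move=> x xr; apply: unit; rewrite inE xr orbT.
  rewrite !mulmxA -mulmxA (_ : (M - z%:M) *m M = M *m (M - z%:M)) ?mulmxA ?hW //.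
  by rewrite mulmxBl mulmxBr scalar_mxC.
have uz := unit z (mem_head _ _).
suff : (1%:M - z *: M^T) *m W = 0 by move/(canRL (mulKmx uz)); rewrite mulmx0.
rewrite mulmxBl mul1mx -scalemxAl; apply/eqP; rewrite subr_eq0; apply/eqP.
move/eqP: WM; rewrite mulmxBr subr_eq0 mul_mx_scalar => /eqP WM.
by rewrite -{1}hW -mulmxA WM -scalemxAr.
Qed.

Lemma sum_ltpairs (V : nmodType) (n : nat) (F : 'I_n -> 'I_n -> V) :
  (forall i, F i i = 0) ->
  \sum_i \sum_j F i j = \sum_(p in ltpairs n) (F p.1 p.2 + F p.2 p.1).
Proof.
move=> F0; rewrite pair_big /= (bigID (mem (ltpairs n))) /= big_split; congr (_ + _).
rewrite [LHS](bigID (fun p : 'I_n * 'I_n => p.2 < p.1)%N) /= addrC big1 ?add0r; last first.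
  move=> [i j] /=; rewrite inE /= -!leqNgt => /andP[ji ij].
  by have -> : i = j by apply/val_inj/anti_leq; rewrite ij ji.
pose sw (p : 'I_n * 'I_n) := (p.2, p.1).
have swK : involutive sw by case.
rewrite (reindex_inj (inv_inj swK)) /=; apply: eq_bigl => -[i j].
by rewrite !inE /= -leqNgt andb_idl // => /ltnW.
Qed.

(** Coordinates on the exterior square: [row_of_alt] and [alt_of_row] identify the row vectors on
    which bialternate products act with alternating matrices. *)
Definition row_of_alt (R : nzRingType) (n : nat) (W : 'M[R]_n) : 'rV[R]_(bialt_dim n) :=
  \row_r W (bialt_pair r).1 (bialt_pair r).2.

(** The sum has at most one term, and none unless [i < j], so [E] is strictly upper triangular. *)
Definition alt_of_row (R : nzRingType) (n : nat) (w : 'rV[R]_(bialt_dim n)) : 'M[R]_n :=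
  let E := \matrix_(i, j) \sum_(r | bialt_pair r == (i, j)) w 0 r in E - E^T.

Lemma bialt_pair_lt (n : nat) (r : 'I_(bialt_dim n)) :
  ((bialt_pair r).1 < (bialt_pair r).2)%N.
Proof. by have := enum_valP (cast_ord (esym (card_ltpairs n)) r); rewrite inE. Qed.

Lemma bialt_pair_inj (n : nat) : injective (@bialt_pair n).
Proof. by move=> r s /enum_val_inj/cast_ord_inj. Qed.

Lemma sum_bialt_pair (V : nmodType) (n : nat) (F : 'I_n * 'I_n -> V) :
  \sum_r F (bialt_pair r) = \sum_(p in ltpairs n) F p.
Proof.
rewrite [RHS]big_enum_val /= (reindex (cast_ord (esym (card_ltpairs n)))) //.
by exists (cast_ord (card_ltpairs n)) => i _; rewrite ?cast_ordK ?cast_ordKV.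
Qed.

Lemma row_of_altK (R : realType) (n : nat) (w : 'rV[R]_(bialt_dim n)) :
  row_of_alt (alt_of_row w) = w.
Proof.
apply/rowP => r; rewrite !mxE -surjective_pairing (big_pred1 r) => [|s]; last first.
  by rewrite (inj_eq (@bialt_pair_inj n)).
rewrite big1 ?subr0 // => s /eqP E.
have := bialt_pair_lt s; rewrite E /= => lt.
by have := bialt_pair_lt r; rewrite ltnNge (ltnW lt).
Qed.

Lemma alt_of_row_tr (R : nzRingType) (n : nat) (w : 'rV[R]_(bialt_dim n)) :
  (alt_of_row w)^T = - alt_of_row w.
Proof. by rewrite /alt_of_row linearB /= trmxK opprB. Qed.

Lemma row_of_alt_eq0 (R : realType) (n : nat) (W : 'M[R]_n) :
  W^T = - W -> row_of_alt W = 0 -> W = 0.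
Proof.
move=> Walt W0.
have alt i j : W j i = - W i j by have := congr1 (fun X : 'M_n => X i j) Walt; rewrite !mxE.
have lt (i j : 'I_n) : (i < j)%N -> W i j = 0.
  move=> ij; have pin : (i, j) \in ltpairs n by rewrite inE.
  pose r := cast_ord (card_ltpairs n) (enum_rank_in pin (i, j)).
  have := congr1 (fun w : 'rV_ _ => w 0 r) W0; rewrite !mxE /bialt_pair /r.
  by rewrite cast_ordK enum_rankK_in.
apply/matrixP => i j; rewrite [RHS]mxE; case: (ltngtP i j) => [/lt //|/lt ji|/val_inj ->].
  by rewrite alt ji oppr0.
by have := alt j j; lra.
Qed.

(* In terms of alternating matrices, [M . M] acts as [W |-> M^T W M]. *)
Lemma row_of_alt_bialternate (R : realType) (n : nat) (M W : 'M[R]_n) :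
  W^T = - W -> row_of_alt W *m bialternate M M = row_of_alt (M^T *m W *m M).
Proof.
move=> Walt.
have alt i j : W j i = - W i j by have := congr1 (fun X : 'M_n => X i j) Walt; rewrite !mxE.
have alt0 i : W i i = 0 by have := alt i i; lra.
apply/rowP => s; rewrite !mxE.
set k := (bialt_pair s).1; set l := (bialt_pair s).2.
transitivity (\sum_i \sum_j W i j * (M i k * M j l)); last first.
  rewrite exchange_big; apply: eq_bigr => j _.
  by rewrite !mxE mulr_suml; apply: eq_bigr => i _; rewrite !mxE; ring.
rewrite sum_ltpairs => [|i]; last by rewrite alt0 mul0r.
rewrite -(sum_bialt_pair (fun p => W p.1 p.2 * (M p.1 k * M p.2 l)
  + W p.2 p.1 * (M p.2 k * M p.1 l))).
apply: eq_bigr => r _; rewrite !mxE (alt (bialt_pair r).1) /k /l.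
by case: (bialt_pair r) => i j; case: (bialt_pair s) => k' l' /=; field.
Qed.

(** A fixed row vector corresponds to an alternating [W] with [M^T W M = W], which [stein_trivial]
    forces to be 0. *)
Lemma schur_stable_bialternate (R : realType) (n : nat) (M : 'M[R]_n) :
  schur_stable M -> ~ eigenvalue (bialternate M M) 1.
Proof.
move=> st /eigenvalueP[w]; rewrite scale1r => wM /negP; apply.
have wE := esym (row_of_altK w); move: (alt_of_row w) (alt_of_row_tr w) wE => W Walt wE.
have MW : M^T *m W *m M = W.
  apply/eqP; rewrite -subr_eq0; apply/eqP; apply: row_of_alt_eq0.
    by rewrite linearB /= !trmx_mul trmxK Walt mulNmx mulmxN mulmxA opprD.
  have -> : row_of_alt (M^T *m W *m M - W) = row_of_alt (M^T *m W *m M) - row_of_alt W.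
    by apply/rowP => r; rewrite !mxE.
  by rewrite -row_of_alt_bialternate // -wE wM subrr.
have : map_mx (real_complex R) W = 0.
  apply: (@stein_trivial _ _ (map_mx (real_complex R) M)) => //.
  by rewrite map_trmx -!map_mxM MW.
move/eqP; rewrite map_mx_eq0 wE => /eqP ->.
by apply/eqP/rowP => r; rewrite !mxE.
Qed.

Lemma eigenvalue_bialternate1 (R : realType) (n : nat) (M : 'M[R]_n) (z : R[i]) :
  eigenvalue (map_mx (real_complex R) M) z -> `|z| = 1 -> complex.Im z != 0 ->
  eigenvalue (bialternate M M) 1.
Proof.
move=> /eigenvalueP[v vM v0] z1 b0.
pose a := complex.Re z; pose b := complex.Im z.
have ab : a ^+ 2 + b ^+ 2 = 1.
  rewrite -cabs_sqr (_ : cabs z = 1) ?expr1n //.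
  by apply: (@complexI R); rewrite -norm_cabs z1.
pose x : 'rV[R]_n := map_mx (@complex.Re R) v.
pose y : 'rV[R]_n := map_mx (@complex.Im R) v.
have vE : v = map_mx (real_complex R) x + 'i%C *: map_mx (real_complex R) y.
  by apply/rowP => i; rewrite !mxE; exact: complexE.
have ReIm (p q : 'rV[R]_n) (w : 'rV[R[i]]_n) :
    w = map_mx (real_complex R) p + 'i%C *: map_mx (real_complex R) q ->
    p = map_mx (@complex.Re R) w /\ q = map_mx (@complex.Im R) w.
  move=> ->; split; apply/rowP => i; rewrite !mxE /=; ring.
have [xM yM] : x *m M = a *: x - b *: y /\ y *m M = b *: x + a *: y.
  have := ReIm (x *m M) (y *m M) (z *: v).
  rewrite -vM {1}vE mulmxDl -scalemxAl -!map_mxM => /(_ erefl)[-> ->].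
  rewrite vM; split; apply/rowP => i; rewrite !mxE /a /b;
    by case: (z) (v 0 i) => [? ?] [? ?] /=; ring.
(* [W] represents the wedge of [x] and [y]. On the pair [(x, y)] the matrix [M] acts with
   determinant [a^2 + b^2 = 1], so [W] is fixed. *)
pose W := x^T *m y - y^T *m x.
have Walt : W^T = - W by rewrite /W linearB /= !trmx_mul !trmxK opprB.
have MW : M^T *m W *m M = W.
  rewrite /W mulmxBr mulmxBl !mulmxA -!trmx_mul -!mulmxA xM yM.
  apply/matrixP => i j; rewrite !mxE !big_ord1 !mxE.
  by rewrite -[RHS]mul1r -ab; ring.
apply/(@eigenvalueP R); exists (row_of_alt W).
  by rewrite row_of_alt_bialternate // MW scale1r.
(* If [W = 0], then [x_l y = y_l x] for all [l]. Applying [M] and reading off coordinate [l] gives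
   [b (x_l^2 + y_l^2) = 0], hence [v = 0]. *)
apply: contraNneq v0 => /(row_of_alt_eq0 Walt) W0.
have xy k l : x 0 k * y 0 l = y 0 k * x 0 l.
  by have := congr1 (fun X : 'M_n => X k l) W0; rewrite !mxE !big_ord1 !mxE => /subr0_eq.
have xyM l : x 0 l *: (y *m M) = y 0 l *: (x *m M).
  by rewrite !scalemxAl; congr (_ *m M); apply/rowP => k; have := xy k l; rewrite !mxE; lra.
apply/eqP/rowP => l; rewrite [RHS]mxE.
have := congr1 (fun X : 'rV_n => X 0 l) (xyM l); rewrite xM yM !mxE => E.
have : b * (complex.Re (v 0 l) ^+ 2 + complex.Im (v 0 l) ^+ 2) = 0 by move: E; lra.
move/eqP; rewrite mulf_eq0 (negPf b0) /= paddr_eq0 ?sqr_ge0 // !sqrf_eq0.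
by move=> /andP[/eqP h1 /eqP h2]; rewrite [LHS]complexE h1 h2 mulr0 addr0.
Qed.

(** With [D = M' - M], symmetry and bilinearity give [M . M + 2 t (D . M) + t^2 (D . D)]; here
    [D . D = 0] as the 2x2 minors of a dyad vanish, and [D . M = M' . M - M . M]. *)
Lemma bialternate_segment (R : realType) (n : nat) (M M' : 'M[R]_n) (t : R) :
  dyadic (M' - M) ->
  1%:M - bialternate (segment M M' t) (segment M M' t)
  = bialt_F0 M + t *: bialt_F1 M' M.
Proof.
case=> u [v E]; rewrite segmentE E (canRL (subrK _) E) /bialt_F0 /bialt_F1.
apply/matrixP => r s; rewrite !mxE.
case: (bialt_pair r) => i j; case: (bialt_pair s) => k l.
by rewrite !mxE !big_ord1; field.
Qed.

(** * Characterization of stable segments *)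

Lemma schur_stable_eigenvalue (R : realType) (n : nat) (M : 'M[R]_n) (x : R) :
  schur_stable M -> eigenvalue M x -> `|x| < 1.
Proof.
move=> st; rewrite -(eigenvalue_map (real_complex R)) => /st.
by rewrite norm_real_complex -[1]/(1%:C%C) ltcR.
Qed.

(** The condition [e * e = 1] treats [e = 1] and [e = -1], hence both matrix quotients in (i), at
    once. *)
Lemma eigenvalue_sub_scale (F : fieldType) (n : nat) (M : 'M[F]_n) (e : F) :
  e * e = 1 ->
  reflect (exists2 v : 'rV_n, v *m (1%:M - e *: M) = 0 & v != 0) (eigenvalue M e).
Proof.
move=> ee; apply: (iffP eigenvalueP) => - [v vM v0]; exists v => //.
  by rewrite mulmxBr mulmx1 -scalemxAr vM scalerA ee scale1r subrr.
move/eqP: vM; rewrite mulmxBr mulmx1 -scalemxAr subr_eq0 => /eqP vM.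
by rewrite {2}vM scalerA ee scale1r.
Qed.

Lemma unitmx_no_kernel (F : fieldType) (n : nat) (K : 'M[F]_n) :
  (forall v : 'rV_n, v *m K = 0 -> v = 0) -> K \in unitmx.
Proof.
move=> inj; rewrite -row_free_unit; apply/row_freeP.
by case: (row_freeP (inj_row_free inj)) => X; exists X.
Qed.

(* [t = 1 / (1 - x)] turns [v (1 - e M') = x v (1 - e M)] with [x < 0] into
   [v (1 - e segment M M' t) = 0] with [0 < t < 1]. *)
Lemma segment_eigenvalue_real (R : realType) (n : nat) (M M' : 'M[R]_n) (e : R) :
  e * e = 1 -> schur_stable M -> schur_stable M' ->
  (forall x : R, eigenvalue ((1%:M - e *: M') *m invmx (1%:M - e *: M)) x -> ~ (x < 0))
  <-> (forall t, 0 <= t <= 1 -> ~ eigenvalue (segment M M' t) e).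
Proof.
move=> ee stM stM'.
have e1 : `|e| = 1.
  by apply/eqP; rewrite -(@pexpr_eq1 _ _ 2) // -normrX expr2 ee normr1.
have noe (K : 'M[R]_n) : schur_stable K -> ~ eigenvalue K e.
  by move=> st /(schur_stable_eigenvalue st); rewrite e1 ltxx.
have KU : 1%:M - e *: M \in unitmx.
  apply: unitmx_no_kernel => v vK; apply/eqP/negPn/negP => v0.
  by apply: (noe _ stM); apply/eigenvalue_sub_scale => //; exists v.
have segE t : 1%:M - e *: segment M M' t
    = (1 - t) *: (1%:M - e *: M) + t *: (1%:M - e *: M').
  by apply/matrixP => i j; rewrite !mxE; ring.
split=> [H t /andP[t0 t1] /(eigenvalue_sub_scale _ ee)[v] | H x /eigenvalueP[v vx v0] x0].
  rewrite segE mulmxDr -!scalemxAr => vE v0.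
  have tn : t != 0.
    apply: contra_not_neq (noe _ stM) => tE; apply/eigenvalue_sub_scale => //.
    by exists v => //; move: vE; rewrite tE subr0 scale1r scale0r addr0.
  have t1n : t != 1.
    apply: contra_not_neq (noe _ stM') => tE; apply/eigenvalue_sub_scale => //.
    by exists v => //; move: vE; rewrite tE subrr scale1r scale0r add0r.
  apply: (H (- ((1 - t) / t))); last first.
    by rewrite oppr_lt0 divr_gt0 // ?subr_gt0 lt_neqAle ?t1n // eq_sym tn.
  apply/eigenvalueP; exists v => //.
  have -> : v *m ((1%:M - e *: M') *m invmx (1%:M - e *: M))
     = (- ((1 - t) / t)) *: (v *m (1%:M - e *: M)) *m invmx (1%:M - e *: M).
    rewrite mulmxA; congr (_ *m _); apply: (scalerI tn).
    rewrite scalerA mulrN mulrC divfK // scaleNr.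
    by apply/eqP; rewrite -addr_eq0 addrC vE.
  by rewrite -scalemxAl mulmxK.
have x1 : 1 - x != 0 by apply/eqP; lra.
apply: (H (1 - x)^-1).
  by rewrite invr_ge0 invf_le1; [|lra]; apply/andP; split; lra.
apply/eigenvalue_sub_scale => //; exists v => //.
have vK : v *m (1%:M - e *: M') = x *: (v *m (1%:M - e *: M)).
  by rewrite scalemxAl -vx mulmxA mulmxKV.
rewrite segE mulmxDr -!scalemxAr vK scalerA -scalerDl.
rewrite (_ : _ + _ = 0) ?scale0r //; field; lra.
Qed.

(** The substitution is [x = 1 / t]: [v (F0 + t F1) = 0] says that [v F0] is an eigenvector of
    [- F0^-1 F1] for [1 / t]. Stability of [M] makes [F0] invertible and so excludes [t = 0]. *)
Lemma segment_eigenvalue_bialternate (R : realType) (n : nat) (M M' : 'M[R]_n) :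
  dyadic (M' - M) -> schur_stable M ->
  (forall x : R, eigenvalue (- (invmx (bialt_F0 M) *m bialt_F1 M' M)) x -> ~ (1 <= x))
  <-> (forall t, 0 <= t <= 1 ->
        ~ eigenvalue (bialternate (segment M M' t) (segment M M' t)) 1).
Proof.
move=> dy stM; set F0 := bialt_F0 M; set F1 := bialt_F1 M' M.
have FE t v : v *m bialternate (segment M M' t) (segment M M' t) = 1 *: v
              <-> v *m F0 + t *: (v *m F1) = 0.
  rewrite scale1r scalemxAr -mulmxDr -bialternate_segment // mulmxBr mulmx1.
  by split=> [->|/subr0_eq <-]; rewrite ?subrr.
have F0U : F0 \in unitmx.
  apply: unitmx_no_kernel => v vK; apply/eqP/negPn/negP => v0.
  apply: (schur_stable_bialternate stM); apply/eigenvalueP; exists v => //.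
  by rewrite -(segment0 M M'); apply/FE; rewrite vK scale0r addr0.
split=> [H t /andP[t0 t1] /eigenvalueP[v /FE vE v0] | H x /eigenvalueP[v vx v0] x1].
  have tn : t != 0.
    apply: contraNneq v0 => tE; move: vE; rewrite tE scale0r addr0.
    by move/(canRL (mulmxK F0U)) => ->; rewrite mul0mx.
  have tp : 0 < t by rewrite lt_def tn.
  apply: (H t^-1); last by rewrite invf_ge1.
  apply/eigenvalueP; exists (v *m F0); last first.
    by apply: contraNneq v0 => /(canRL (mulmxK F0U)) ->; rewrite mul0mx.
  rewrite mulmxN mulmxA mulmxK //; apply: (scalerI tn).
  rewrite scalerA divff // scale1r scalerN; apply/esym/eqP.
  by rewrite -addr_eq0 vE.
have x0 : x != 0 by apply/eqP; lra.
apply: (H x^-1); first by rewrite invr_ge0 invf_le1; [|lra]; apply/andP; split; lra.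
apply/eigenvalueP; exists (v *m invmx F0); last first.
  by apply: contraNneq v0 => /(canRL (mulmxKV F0U)) ->; rewrite mul0mx.
apply/FE; rewrite mulmxKV //; apply: (scalerI x0).
rewrite scalerDr scalerA divff // scale1r scaler0 -vx mulmxN mulmxA.
by rewrite addNr.
Qed.

(** In the theorem [M] is [A j] and [M'] is [A i]: inverses are taken at the starting end of the
    segment. *)
Lemma stable_segmentP (R : realType) (n : nat) (M M' : 'M[R]_n) :
  dyadic (M' - M) -> schur_stable M -> schur_stable M' ->
  stable_segment M M' <->
  [/\ forall x, eigenvalue ((1%:M - M') *m invmx (1%:M - M)) x -> ~ (x < 0),
      forall x, eigenvalue ((1%:M + M') *m invmx (1%:M + M)) x -> ~ (x < 0)
    & forall x, eigenvalue (- (invmx (bialt_F0 M) *m bialt_F1 M' M)) x -> ~ (1 <= x)].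
Proof.
move=> dy stM stM'.
have [p1 p2] := segment_eigenvalue_real (mulr1 1) stM stM'.
have [m1 m2] := segment_eigenvalue_real (etrans (mulrNN 1 1) (mulr1 1)) stM stM'.
have [b1 b2] := segment_eigenvalue_bialternate dy stM.
rewrite !scale1r in p1 p2; rewrite !scaleN1r !opprK in m1 m2.
have noe t (e : R) : stable_segment M M' -> `|e| = 1 -> 0 <= t <= 1 ->
    ~ eigenvalue (segment M M' t) e.
  by move=> st e1 /st/schur_stable_eigenvalue H /H; rewrite e1 ltxx.
split=> [st | [/p1 H1 /m1 H2 /b1 H3]].
  split; [apply: p2 | apply: m2 | apply: b2] => t t01.
  + by apply: noe => //; rewrite normr1.
  + by apply: noe => //; rewrite normrN1.
  + exact/schur_stable_bialternate/st.
apply: stable_segment_crossing => // t z t01 z1; apply/negP => ev.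
have [zi|zi] := eqVneq (complex.Im z) 0; last first.
  exact: (H3 _ t01 (eigenvalue_bialternate1 ev z1 zi)).
have zE : z = (complex.Re z)%:C%C by case: z zi {z1 ev} => a b /= ->.
move: ev z1; rewrite zE eigenvalue_map norm_real_complex => ev /complexI z1.
have /orP[/eqP zz|/eqP zz] : (complex.Re z == 1) || (complex.Re z == - 1).
- by rewrite -eqr_norm2 normr1 z1.
- by apply: (H1 _ t01); rewrite -zz.
- by apply: (H2 _ t01); rewrite -zz.
Qed.

Lemma in_conv_hull_segment (R : realType) (n N : nat) (A : 'I_N -> 'M[R]_n)
    (i j : 'I_N) (t : R) :
  0 <= t <= 1 -> in_conv_hull A (segment (A i) (A j) t).
Proof.
move=> /andP[t0 t1].
have sumD (V : nmodType) (F : bool -> V) k : F false = 0 ->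
    \sum_(l < N) F (l == k) = F true.
  by move=> F0; rewrite (bigD1 k) //= eqxx big1 ?addr0 // => l /negPf ->.
(* Adding two indicator weights also covers [i = j]. *)
exists (fun k => (1 - t) *+ (k == i) + t *+ (k == j)); split.
- by move=> k; rewrite addr_ge0 // mulrn_wge0 // subr_ge0.
- rewrite big_split /= (sumD _ (fun b => (1 - t) *+ b)) //.
  by rewrite (sumD _ (fun b => t *+ b)) // subrK.
under eq_bigr do rewrite scalerDl.
rewrite big_split /=; congr (_ + _).
  rewrite (bigD1 i) //= eqxx big1 ?addr0 // => k /negPf ->.
  by rewrite scale0r.
rewrite (bigD1 j) //= eqxx big1 ?addr0 // => k /negPf ->.
by rewrite scale0r.
Qed.

Theorem theorem3p6 (R : realType) (n N : nat) (B0 : 'M[R]_n)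
    (B A : 'I_N -> 'M[R]_n)
    (hrank : forall i, \rank (B i) = 1%N)
    (hB : (exists (b : 'cV[R]_n) (c : 'I_N -> 'cV[R]_n),
             forall i, B i = b *m (c i)^T)
          \/ (exists (c : 'cV[R]_n) (b : 'I_N -> 'cV[R]_n),
                forall i, B i = b i *m c^T))
    (hA : forall i, A i = B0 + B i)
    (hstable : forall i, schur_stable (A i)) :
  (forall M : 'M[R]_n, in_conv_hull A M -> schur_stable M)
  <->
  ((forall i j : 'I_N, (i < j)%N ->
      (forall x : R,
         eigenvalue ((1%:M - A i) *m invmx (1%:M - A j)) x -> ~ (x < 0))
      /\ (forall x : R,
            eigenvalue ((1%:M + A i) *m invmx (1%:M + A j)) x -> ~ (x < 0)))
   /\
   (forall i j : 'I_N, (i < j)%N ->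
      forall x : R,
        eigenvalue (- (invmx (bialt_F0 (A j)) *m bialt_F1 (A i) (A j))) x ->
        ~ (1 <= x))).
Proof.
(* [S] unifies the two rank-one cases: it is the affine family [B0 + b v] with [v] free, or
   [B0 + u c^T] with [u] free. *)
suff [S [dyS cvS SA]] : exists S : 'M[R]_n -> Prop,
    [/\ forall M M', S M -> S M' -> dyadic (M' - M),
        forall M M' t, S M -> S M' -> 0 <= t <= 1 -> S (segment M M' t)
      & forall i, S (A i)].
  have edge i j := stable_segmentP (dyS _ _ (SA j) (SA i)) (hstable j) (hstable i).
  split=> [st | [H1 H2]].
    have stA i j : stable_segment (A j) (A i).
      by move=> t t01; apply/st/in_conv_hull_segment.
    by split=> i j ij; have [/(_ (stA i j))[]] := edge i j.
  apply: (conv_hull_stable dyS cvS SA) => i j.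
  (* The conditions speak only of [k < l]; reversal of segments gives the other order, and stability
     of the vertices the case of equal indices. *)
  have stA (k l : 'I_N) : (k < l)%N -> stable_segment (A l) (A k).
    by move=> kl; apply/edge; split; [case: (H1 _ _ kl)|case: (H1 _ _ kl)|exact: H2 kl].
  case: (ltngtP i j) => [ij|ji|/val_inj <-].
  - exact/stable_segment_sym/stA.
  - exact: stA.
  - exact: stable_segment_refl.
case: hB => [[b [c hb]] | [c [b hb]]].
  exists (fun M => exists v : 'rV_n, M = B0 + b *m v); split.
  - move=> _ _ [v ->] [v' ->]; exists b, (v' - v).
    by rewrite opprD addrACA subrr add0r mulmxBr.
  - move=> _ _ t [v ->] [v' ->] _; exists ((1 - t) *: v + t *: v').
    by rewrite /segment !scalerDr mulmxDr !scalemxAr addrACA -scalerDl subrK scale1r.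
  - by move=> i; exists (c i)^T; rewrite hA hb.
exists (fun M => exists u : 'cV_n, M = B0 + u *m c^T); split.
- move=> _ _ [v ->] [v' ->]; exists (v' - v), c^T.
  by rewrite opprD addrACA subrr add0r mulmxBl.
- move=> _ _ t [v ->] [v' ->] _; exists ((1 - t) *: v + t *: v').
  by rewrite /segment !scalerDr mulmxDl !scalemxAl addrACA -scalerDl subrK scale1r.
- by move=> i; exists (b i); rewrite hA hb.
Qed.
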